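(* Let $G$ be a finite simple graph. If $G$ is bipartite and $G$ is the complement of a circle graph (equivalently, the complement $\overline{G}$ is a circle graph), then $G$ is a circle graph.
   Context: A graph $H$ is a circle graph if it is the intersection graph of chords of a circle: there exist a circle $C$ in the plane and, for each vertex $v$ of $H$, a chord $c_v$ of $C$ (a closed line segment joining two points of $C$), such that any two distinct vertices $u$ and $v$ are adjacent in $H$ if and only if the chords $c_u$ and $c_v$ intersect. The complement $\overline{G}$ of a graph $G$ has the same vertex set as $G$, and two distinct vertices are adjacent in $\overline{G}$ if and only if they are not adjacent in $G$. *)

(* Defs.v *)
From mathcomp Require Import all_boot all_order all_algebra.
From mathcomp Require Import classical_sets reals.

Set Implicit Arguments.
Unset Strict Implicit.
Unset Printing Implicit Defensive.

Import Order.TTheory GRing.Theory Num.Theory.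
Local Open Scope classical_set_scope.
Local Open Scope ring_scope.

Record sgraph := SGraph {
  vertex :> finType;
  adj : rel vertex;
  adj_sym : symmetric adj;
  adj_irr : irreflexive adj }.

Definition compl_adj (G : sgraph) : rel G :=
  fun u v => (u != v) && ~~ adj u v.

Lemma compl_adj_sym (G : sgraph) : symmetric (@compl_adj G).
Proof. by move=> u v; rewrite /compl_adj eq_sym adj_sym. Qed.

Lemma compl_adj_irr (G : sgraph) : irreflexive (@compl_adj G).
Proof. by move=> u; rewrite /compl_adj eqxx. Qed.

Definition compl (G : sgraph) : sgraph :=
  SGraph (@compl_adj_sym G) (@compl_adj_irr G).

(* [A] and its complement are the two colour classes; either may be empty. *)
Definition bipartite (G : sgraph) : Prop :=
  exists A : {set G}, forall u v : G, adj u v -> (u \in A) != (v \in A).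

Definition circle (R : realType) (o : 'rV[R]_2) (r : R) : set 'rV[R]_2 :=
  [set p | \sum_(i < 2) (p 0 i - o 0 i) ^+ 2 = r ^+ 2].

Definition segment (R : realType) (a b : 'rV[R]_2) : set 'rV[R]_2 :=
  [set (1 - t) *: a + t *: b | t in [set t : R | 0 <= t <= 1]].

(* The endpoints of a chord are distinct, but distinct vertices may have
   chords that share an endpoint (and hence intersect) or coincide. *)
Definition is_chord (R : realType) (C c : set 'rV[R]_2) : Prop :=
  exists a b : 'rV[R]_2, [/\ C a, C b, a != b & c = segment a b].

Definition circle_graph (R : realType) (H : sgraph) : Prop :=
  exists (o : 'rV[R]_2) (r : R) (c : H -> set 'rV[R]_2),
    [/\ 0 < r,
        forall v, is_chord (circle o r) (c v)
      & forall u v : H, u != v -> (adj u v <-> c u `&` c v !=set0)].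

(* Main.v *)
(* A chord diagram is a set of 2n positions on a line, paired into chords; two
   chords meet iff their ends interlace. If each of the two colour classes
   consists of pairwise meeting chords, then some arc contains exactly one end
   of every chord, by an intermediate value argument: each class alone
   determines an "antipodal map" on the circle, and two antipodal maps agree
   somewhere. Reflecting that arc turns every interlaced pair of chords into a
   non-interlaced one and vice versa, which gives a diagram of the complement.
   Two facts connect this to geometry: the chords ab and cd of a circle meet iff
   c and d are weakly on opposite sides of the line ab, and under the half-angle
   parametrisation this is a sign condition on differences of parameters. *)
Require Import Defs.
From mathcomp Require Import all_boot all_order all_algebra.
From mathcomp Require Import boolp classical_sets reals.
From mathcomp Require Import zify ring lra.

Set Implicit Arguments.
Unset Strict Implicit.
Unset Printing Implicit Defensive.

Import Order.TTheory GRing.Theory Num.Theory.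

(** * Chord diagrams with distinct ends *)

Section Interlacing.
Variable V : finType.
Implicit Types (l r : V -> nat) (u v : V).

Definition interlaced l r u v :=
  (l u < l v < r u) && (r u < r v) || (l v < l u < r v) && (r v < r u).

Definition distinct_ends l r :=
  [/\ forall v, l v < r v, forall u v, l u <> r v,
      forall u v, u != v -> l u <> l v & forall u v, u != v -> r u <> r v].

Lemma splitting_arc l r (A : {set V}) :
    distinct_ends l r ->
    (forall u v, u != v -> (u \in A) = (v \in A) -> interlaced l r u v) ->
  exists p q, forall v, (p <= l v < q) != (p <= r v < q).
Proof.
move=> [lr lnr lnl rnr] cliq.
have lr_same u v : (u \in A) = (v \in A) -> l u < r v.
  case: (eqVneq u v) => [->//|uv] /(cliq _ _ uv); rewrite /interlaced; lia.
have mono u v : (u \in A) = (v \in A) -> l u < l v -> r u < r v.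
  case: (eqVneq u v) => [-> _|uv]; first by rewrite ltnn.
  move=> /(cliq _ _ uv); rewrite /interlaced; lia.
(* If every left end precedes every right end, the arc stops just after the last left end. *)
case: (boolP [forall u, forall v, l u < r v]) => [/forallP allr|].
  exists 0, (\max_v l v).+1 => v; have H := @leq_bigmax _ l v.
  suff : \max_v0 l v0 < r v by lia.
  apply: (big_ind (fun x => x < r v)) => [||u _]; last exact: (forallP (allr u)).
  - exact: leq_ltn_trans (lr v).
  - by move=> x y; rewrite gtn_max => -> ->.
rewrite negb_forall => /existsP[b0]; rewrite negb_forall => /existsP[a0 b0a0].
have {b0a0} a0b0 : r a0 < l b0 by have := lnr b0 a0; lia.
have sab : (a0 \in A) != (b0 \in A).
  by apply/eqP => E; have := lr_same b0 a0 (esym E); lia.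
(* [a] is the last chord of the class of [a0] for which the point antipodal to
   its left end comes earlier for its own class than for the class of [b0]; the
   two antipodal points coincide just after that left end. *)
pose m x b := if l b < l x then r b else l b.
pose bad x := ((x \in A) == (a0 \in A)) &&
  [exists b, ((b \in A) == (b0 \in A)) && (r x < m x b)].
have bad0 : bad a0.
  rewrite /bad eqxx; apply/existsP; exists b0; rewrite eqxx /m.
  by case: ifP => // H; have := lr a0; lia.
pose a := [arg max_(x > a0 | bad x) l x].
have [bada amax] : bad a /\ forall x, bad x -> l x <= l a.
  by rewrite /a; case: arg_maxnP => // x bx H; split => // y /H.
case/andP: (bada) => /eqP aA /existsP[b1 /andP[/eqP b1B rab1]].
pose M := \max_(b | (b \in A) == (b0 \in A)) m a b.
have leM b : (b \in A) = (b0 \in A) -> m a b <= M.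
  by move=> E; apply: (@leq_bigmax_cond _ _ (m a)); rewrite E.
have ltM y : 0 < y -> (forall b, (b \in A) = (b0 \in A) -> m a b < y) -> M < y.
  move=> y0 H; apply: (big_ind (fun x => x < y)) => [//||b /eqP]; last exact: H.
  by move=> x z; rewrite gtn_max => -> ->.
(* Left ends of the class of [a0] come before [r a0 < l b0], hence before every right end of the
   class of [b0]. So for [b] in the latter class [m a b] is the first end of [b] after [l a], and
   the arc runs up to the last of these. *)
exists (l a).+1, M.+1 => v.
have raM : r a < M by apply: leq_trans rab1 (leM _ b1B).
have := lr v; have := lr a => lra lrv.
case: (eqVneq (v \in A) (a0 \in A)) => vA.
  have := lr_same a v; have := lr_same v a.
  rewrite vA aA => /(_ erefl) h1 /(_ erefl) h2.
  case: (ltngtP (l v) (l a)) => lva.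
  - have := mono v a; rewrite vA aA => /(_ erefl lva); lia.
  - suff : M < r v by lia.
    apply: ltM => [|b bB]; first lia.
    (* By maximality of [a], [v] is not [bad], so [m v b <= r v]; and [m a b <= m v b], as [m] can
       only grow when the starting end moves right. *)
    have : ~~ bad v by apply/negP => /amax; lia.
    rewrite /bad vA eqxx /= negb_exists => /forallP/(_ b).
    rewrite bB eqxx /= -leqNgt.
    have /eqP vb : v != b by apply/eqP => E; move: sab; rewrite -bB -E vA eqxx.
    have nrr : r v <> r b by apply: rnr; apply/eqP.
    have := lnr b v; have := lr b; rewrite /m.
    by case: ifP; case: ifP; lia.
  - have -> : v = a by apply/eqP/negPn/negP => /lnl; rewrite lva.
    lia.
have {}vA : (v \in A) = (b0 \in A).
  by case: (v \in A) (a0 \in A) (b0 \in A) vA sab => [] [] [].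
have := leM v vA; rewrite /m; case: ifP => lva mM.
  by have := lr_same b0 v (esym vA); have := lr_same a a0 aA; lia.
have lav : l a <> l v.
  by apply: lnl; apply/eqP => E; move: sab; rewrite -aA E vA eqxx.
suff : M < r v by lia.
apply: ltM => [|b bB]; first lia.
rewrite /m; case: ifP => lba; last by apply: lr_same; rewrite bB.
by apply: mono; [rewrite bB|lia].
Qed.

(** Read cyclically, two chords interlace exactly when their ends inside the arc and their ends
    outside it come in the same order; the reflection reverses only the inner order. *)
Lemma reflect_arc l r p q :
    distinct_ends l r ->
    (forall v, (p <= l v < q) != (p <= r v < q)) ->
  exists l' r', distinct_ends l' r' /\
    forall u v, u != v -> interlaced l' r' u v = ~~ interlaced l r u v.
Proof.
move=> [lr lnr lnl rnr] split.
pose f x := if p <= x < q then p + q - x.+1 else x.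
have fin x : p <= x < q -> f x = p + q - x.+1 by rewrite /f => ->.
have fout x : (p <= x < q) = false -> f x = x by rewrite /f => ->.
(* In both cases [f] keeps the left end of [v] to the left of its right end. *)
have {split}arc v : p <= l v < q /\ q <= r v /\ f (l v) = p + q - (l v).+1
    /\ f (r v) = r v \/
    l v < p /\ p <= r v < q /\ f (l v) = l v /\ f (r v) = p + q - (r v).+1.
  have := lr v; have := split v.
  case: (boolP (p <= l v < q)) => lv; case: (boolP (p <= r v < q)) => rv // _ lrv.
    by left; rewrite fin // fout; [lia|exact: negbTE].
  by right; rewrite fout ?fin //; [lia|exact: negbTE].
exists (fun v => f (l v)), (fun v => f (r v)); split.
  split.
  - move=> v; have := arc v; lia.
  - move=> u v; have := lnr u v; have := arc u; have := arc v; lia.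
  - move=> u v uv; have := lnl u v uv; have := arc u; have := arc v; lia.
  - move=> u v uv; have := rnr u v uv; have := arc u; have := arc v; lia.
move=> u v uv; have luv := lnl u v uv; have ruv := rnr u v uv.
rewrite /interlaced.
case: (arc u) => [[lu [ru [-> ->]]]|[lu [ru [-> ->]]]];
case: (arc v) => [[lv [rv [-> ->]]]|[lv [rv [-> ->]]]].
- by case: (ltngtP (l u) (l v)) => // ?; case: (ltngtP (r u) (r v)) => // ?; lia.
- have := lnr u v; case: (ltngtP (l u) (r v)) => // ? _; lia.
- have := lnr v u; case: (ltngtP (l v) (r u)) => // ? _; lia.
- by case: (ltngtP (l u) (l v)) => // ?; case: (ltngtP (r u) (r v)) => // ?; lia.
Qed.

End Interlacing.

Local Open Scope ring_scope.

(** * Real ends turned into natural positions *)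

Section Rank.
Context {disp : Order.disp_t} (T : orderType disp) (E : finType) (key : E -> T).

Definition rank e := #|[set x | (key x < key e)%O]|.

Lemma ltn_rank e1 e2 : (rank e1 < rank e2)%N = (key e1 < key e2)%O.
Proof.
have le_rank x y : (key x <= key y)%O -> (rank x <= rank y)%N.
  move=> xy; apply: subset_leq_card; apply/fintype.subsetP => z.
  by rewrite !inE => /lt_le_trans; apply.
case: (leP (key e2) (key e1)) => [/le_rank|lt12]; first by rewrite ltnNge => ->.
apply: proper_card; apply/properP; split.
  by apply/fintype.subsetP => z; rewrite !inE => /lt_trans; apply.
by exists e1; rewrite !inE ?lt12 ?ltxx.
Qed.

End Rank.

(** For pairs with distinct ends, negative when they strictly interlace and zero when they share an
    end; the order within a pair is immaterial. *)
Definition crossing (R : pzRingType) (s t : R * R) : R :=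
  (s.1 - t.1) * (s.1 - t.2) * (s.2 - t.1) * (s.2 - t.2).

Lemma crossing_le0E (R : realDomainType) (s t : R * R) :
  s.1 < s.2 -> t.1 < t.2 ->
  (crossing s t <= 0) =
  ((s.1 <= t.1 <= s.2) && (s.2 <= t.2) || (t.1 <= s.1 <= t.2) && (t.2 <= s.2)).
Proof.
case: s t => [a b] [c d] /= ab cd; rewrite /crossing /=.
have [ac|ca|ac] := ltrgtP a c.
- rewrite orbF -!mulrA nmulr_rle0 ?subr_lt0 // nmulr_rge0; last first.
    by rewrite subr_lt0 (lt_trans ac).
  have [bd|db|->] := ltrgtP b d; last by rewrite subrr mulr0 lexx ltW.
    by rewrite nmulr_lle0 ?subr_lt0 // subr_ge0 andbT.
  by rewrite andbF pmulr_lle0 ?subr_gt0 // subr_le0 leNgt (lt_trans cd).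
- have -> : (a - c) * (a - d) * (b - c) * (b - d) =
      (a - c) * ((b - c) * ((a - d) * (b - d))) by ring.
  rewrite /= pmulr_rle0 ?subr_gt0 // pmulr_rle0 ?subr_gt0 ?(lt_trans ca) //.
  have [bd|db|<-] := ltrgtP b d; last by rewrite subrr mulr0 lexx ltW.
    by rewrite andbF nmulr_lle0 ?subr_lt0 // subr_ge0 leNgt (lt_trans ab).
  by rewrite andbT pmulr_lle0 ?subr_gt0 // subr_le0.
by rewrite -ac subrr !mul0r lexx (ltW ab) ac (ltW cd) le_total.
Qed.

(** * Separation of coinciding ends *)

Section Untie.
Variables (R : realDomainType) (V : finType) (s : V -> R * R).
Hypothesis lt_s : forall v, (s v).1 < (s v).2.

(* Coinciding ends are separated so that chords sharing an end interlace: left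
   ends come before right ends, then the chord whose other end is farther left
   comes first. *)
Definition end_key (e : V * bool) : seqlexi R :=
  let: (v, b) := e in
  [:: if b then (s v).2 else (s v).1; b%:R; if b then (s v).1 else (s v).2;
      (nat_of_ord (enum_rank v))%:R].

Definition left_pos v := rank end_key (v, false).
Definition right_pos v := rank end_key (v, true).

Lemma left_left u v : (left_pos u < left_pos v)%N =
  ((s u).1 < (s v).1) || ((s u).1 == (s v).1) && (((s u).2 < (s v).2) ||
  ((s u).2 == (s v).2) && (enum_rank u < enum_rank v)%N).
Proof.
rewrite ltn_rank /end_key !ltxi_cons ltxis0 lexx /= !ler_nat.
by do 2!case: ltgtP; rewrite ?andbT ?andbF //=; lia.
Qed.

Lemma right_right u v : (right_pos u < right_pos v)%N =
  ((s u).2 < (s v).2) || ((s u).2 == (s v).2) && (((s u).1 < (s v).1) ||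
  ((s u).1 == (s v).1) && (enum_rank u < enum_rank v)%N).
Proof.
rewrite ltn_rank /end_key !ltxi_cons ltxis0 lexx /= !ler_nat.
by do 2!case: ltgtP; rewrite ?andbT ?andbF //=; lia.
Qed.

Lemma left_right u v : (left_pos u < right_pos v)%N = ((s u).1 <= (s v).2).
Proof. by rewrite ltn_rank /end_key !ltxi_cons ler01 ler10 /= implybT andbT. Qed.

Lemma right_left u v : (right_pos u < left_pos v)%N = ((s u).2 < (s v).1).
Proof.
rewrite ltn_rank /end_key !ltxi_cons ler01 ler10 /= implybF -ltNge.
by apply: andb_idl => /ltW.
Qed.

Lemma distinct_ends_pos : distinct_ends left_pos right_pos.
Proof.
split=> [v|u v|u v|u v].
- by rewrite left_right ltW.
- move=> E; have := left_right u v; have := right_left v u; rewrite E !ltnn.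
  by rewrite ltNge => /esym/negbFE ->.
- move=> uv E; have := left_left u v; have := left_left v u; rewrite E !ltnn.
  have := inj_eq enum_rank_inj u v; rewrite (negbTE uv) -val_eqE /=.
  by case: (ltrgtP (s u).1); case: (ltrgtP (s u).2); case: (ltngtP (enum_rank u)).
- move=> uv E; have := right_right u v; have := right_right v u; rewrite E !ltnn.
  have := inj_eq enum_rank_inj u v; rewrite (negbTE uv) -val_eqE /=.
  by case: (ltrgtP (s u).1); case: (ltrgtP (s u).2); case: (ltngtP (enum_rank u)).
Qed.

(** A shared end becomes interlacing: common left (or right) ends are ordered like the opposite
    ends, a left end precedes an equal right end, and identical pairs follow [enum_rank] at both
    ends. *)
Lemma crossing_le0 u v : u != v ->
  (crossing (s u) (s v) <= 0) = interlaced left_pos right_pos u v.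
Proof.
move=> uv; rewrite /interlaced !left_left !right_right !left_right /crossing.
have := inj_eq enum_rank_inj u v; rewrite (negbTE uv) -val_eqE /=.
rewrite (crossing_le0E (lt_s u) (lt_s v)).
have := lt_s u; have := lt_s v.
move: (s u) (s v) => [a b] [c d] /= cd ab.
case: (ltngtP (enum_rank u)) => // _ _;
case: (ltrgtP a c) => [ac|ca|ac] /=; case: (ltrgtP b d) => [bd|db|bd] /=;
 rewrite ?andbT ?andbF ?orbF ?orbT //; rewrite -?ac -?bd ?(ltW ab) ?(ltW cd) //.
Qed.

End Untie.

(** * Meeting chords of a circle as a sign condition on parameters *)

Section Chords.
Variable R : realType.
Implicit Types (o a b c d p : 'rV[R]_2) (r x y : R).
Local Notation xcoord p := (p 0 0).
Local Notation ycoord p := (p 0 1).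

Lemma circleE o r p :
  circle o r p <-> (xcoord p - xcoord o) ^+ 2 + (ycoord p - ycoord o) ^+ 2 = r ^+ 2.
Proof.
rewrite /circle /= big_ord_recl big_ord1.
by have -> : lift ord0 ord0 = 1 :> 'I_2 by apply: val_inj.
Qed.

Lemma eq_row2 a b : xcoord a = xcoord b -> ycoord a = ycoord b -> a = b.
Proof.
move=> h0 h1; apply/rowP => i; case: i => [[|[|//]] Hi].
  by have -> : Ordinal Hi = 0 by apply: val_inj.
by have -> : Ordinal Hi = 1 by apply: val_inj.
Qed.

(** Twice the signed area of the triangle [a b c]. *)
Definition orient a b c : R :=
  (xcoord b - xcoord a) * (ycoord c - ycoord a) -
  (ycoord b - ycoord a) * (xcoord c - xcoord a).

(** With [p = (1 - s) a + s b], the power of [p] gives [r^2 - |p - o|^2 = s (1 - s) |b - a|^2], so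
    the disk forces [0 <= s <= 1]. The value of [s] comes from projecting [p] orthogonally to the
    line. *)
Lemma line_disk_segment o r a b p :
    circle o r a -> circle o r b -> a != b -> orient a b p = 0 ->
    (xcoord p - xcoord o) ^+ 2 + (ycoord p - ycoord o) ^+ 2 <= r ^+ 2 ->
  segment a b p.
Proof.
rewrite !circleE /orient => ca cb nab ab0 pD.
pose L := (xcoord b - xcoord a) ^+ 2 + (ycoord b - ycoord a) ^+ 2.
have L0 : 0 < L.
  rewrite lt_neqAle addr_ge0 ?sqr_ge0 // andbT eq_sym paddr_eq0 ?sqr_ge0 //.
  rewrite !sqrf_eq0 !subr_eq0; apply: contraNN nab => /andP[/eqP h0 /eqP h1].
  by apply/eqP; apply: eq_row2.
pose s := ((xcoord p - xcoord a) * (xcoord b - xcoord a) +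
           (ycoord p - ycoord a) * (ycoord b - ycoord a)) / L.
have sL : s * L = (xcoord p - xcoord a) * (xcoord b - xcoord a) +
                  (ycoord p - ycoord a) * (ycoord b - ycoord a).
  by rewrite /s divfK // gt_eqF.
have px : xcoord p = (1 - s) * xcoord a + s * xcoord b.
  apply: (mulIf (lt0r_neq0 L0)).
  have -> : ((1 - s) * xcoord a + s * xcoord b) * L =
    xcoord a * L + (s * L) * (xcoord b - xcoord a) by ring.
  have := congr1 ( *%R (ycoord b - ycoord a)) ab0; rewrite sL mulr0 /L; lra.
have py : ycoord p = (1 - s) * ycoord a + s * ycoord b.
  apply: (mulIf (lt0r_neq0 L0)).
  have -> : ((1 - s) * ycoord a + s * ycoord b) * L =
    ycoord a * L + (s * L) * (ycoord b - ycoord a) by ring.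
  have := congr1 ( *%R (xcoord b - xcoord a)) ab0; rewrite sL mulr0 /L; lra.
have : 0 <= (s * (1 - s)) * L.
  suff -> : (s * (1 - s)) * L =
    r ^+ 2 - ((xcoord p - xcoord o) ^+ 2 + (ycoord p - ycoord o) ^+ 2).
    by rewrite subr_ge0.
  rewrite -[r ^+ 2 in RHS]mul1r -[X in X * r ^+ 2](subrK s) mulrDl -{1}ca -cb.
  rewrite px py /L; ring.
rewrite pmulr_lge0 // => s01.
exists s; first by rewrite /=; nra.
by apply: eq_row2; rewrite !mxE.
Qed.

(** [orient a b] is affine along [c d], so weakly opposite signs give a zero on that segment. By
    convexity this zero lies in the disk, hence on the segment [a b] and not just on its line. *)
Lemma segments_meetP o r a b c d :
    circle o r a -> circle o r b -> circle o r c -> circle o r d -> a != b ->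
  (segment a b `&` segment c d !=set0)%classic <->
  orient a b c * orient a b d <= 0.
Proof.
move=> ca cb cc cd nab.
have orient_conv t : orient a b ((1 - t) *: c + t *: d) =
    (1 - t) * orient a b c + t * orient a b d.
  by rewrite /orient !mxE; ring.
set g := orient a b c in orient_conv *; set h := orient a b d in orient_conv *.
split.
  case=> p [[s _ sp] [t /= /andP[t0 t1] tp]].
  have : orient a b p = 0 by rewrite -sp /orient !mxE; ring.
  rewrite -tp orient_conv; have [->|tn0] := eqVneq t 0; first nra.
  have {tn0}t0 : 0 < t by rewrite lt_neqAle eq_sym tn0.
  move=> gh; rewrite -(pmulr_lle0 _ t0).
  have -> : g * h * t = - ((1 - t) * g ^+ 2) + g * ((1 - t) * g + t * h) by ring.
  by rewrite gh mulr0 addr0 oppr_le0 mulr_ge0 ?sqr_ge0 ?subr_ge0.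
move=> gh; suff [t t01 t0] : exists2 t, 0 <= t <= 1 & (1 - t) * g + t * h = 0.
  exists ((1 - t) *: c + t *: d); split; last by exists t.
  apply: (line_disk_segment ca cb nab); first by rewrite orient_conv.
  move: cc cd; rewrite !circleE !mxE => cc cd.
  rewrite -subr_ge0 -[r ^+ 2]mul1r -[X in X * r ^+ 2](subrK t) mulrDl -{1}cc -cd.
  set E := (X in 0 <= X).
  have -> : E = t * (1 - t) *
      ((xcoord c - xcoord d) ^+ 2 + (ycoord c - ycoord d) ^+ 2).
    by rewrite /E; ring.
  by case/andP: t01 => ? ?; rewrite !mulr_ge0 ?subr_ge0 ?addr_ge0 ?sqr_ge0.
(* If [g = h], then [g * h <= 0] makes both zero and any [t] will do. *)
have [/eqP|ngh] := eqVneq (g - h) 0.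
  rewrite subr_eq0 => /eqP E; exists 0; first by rewrite lexx ler01.
  move: gh; rewrite -E -expr2 => gh.
  have /eqP := le_anti (introT andP (conj gh (sqr_ge0 g))).
  by rewrite sqrf_eq0 => /eqP ->; ring.
exists (g / (g - h)); last by field.
move: ngh gh; rewrite neq_lt => /orP[] gh0 gh.
  by rewrite ler_ndivlMr // mul0r ler_ndivrMr // mul1r; nra.
by rewrite ler_pdivlMr // mul0r ler_pdivrMr // mul1r; nra.
Qed.

(* [p = o + r (cos 2f, sin 2f)] with [(x, y)] a nonzero multiple of
   [(cos f, sin f)]. *)
Definition on_param o r p x y :=
  [/\ 0 < x ^+ 2 + y ^+ 2,
      xcoord p = xcoord o + r * (x ^+ 2 - y ^+ 2) / (x ^+ 2 + y ^+ 2) &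
      ycoord p = ycoord o + r * (2 * x * y) / (x ^+ 2 + y ^+ 2)].

Lemma on_param_circle o r p x y : on_param o r p x y -> circle o r p.
Proof.
move=> [/lt0r_neq0 n0 px py]; apply/circleE; rewrite px py; field.
exact: n0.
Qed.

(** With [(u, w) = p - o], the vector [(r + u, w)] is the sum of [(r, 0)] and [(u, w)], which have
    equal length, so it bisects their angle. It vanishes only for [u = - r], where the half angle is
    a right angle. *)
Lemma circle_on_param o r p : 0 < r -> circle o r p ->
  exists x y, on_param o r p x y.
Proof.
move=> r0 /circleE.
set u := xcoord p - xcoord o; set w := ycoord p - ycoord o => E.
have ux : xcoord p = xcoord o + u by rewrite /u; ring.
have wy : ycoord p = ycoord o + w by rewrite /w; ring.
have [u0|un0] := eqVneq (r + u) 0.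
  have w0 : w = 0.
    by apply/eqP; rewrite -sqrf_eq0; apply/eqP; have := congr1 ( *%R (r - u)) u0; lra.
  exists 0, 1; split; rewrite ?ux ?wy ?w0.
  - by rewrite expr0n add0r expr1n ltr01.
  - by rewrite -[u](addKr r) addrC u0; field.
  - by field.
exists (r + u), w.
have NE : (r + u) ^+ 2 + w ^+ 2 = 2 * r * (r + u).
  by rewrite (_ : w ^+ 2 = r ^+ 2 - u ^+ 2); [ring|lra].
split.
- by apply: ltr_pwDl; rewrite ?sqr_ge0 // lt_neqAle sqr_ge0 eq_sym sqrf_eq0 un0.
- rewrite NE (_ : w ^+ 2 = r ^+ 2 - u ^+ 2) ?ux; last lra.
  by field; rewrite un0 gt_eqF.
- by rewrite NE wy; field; rewrite un0 gt_eqF.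
Qed.

(** After normalisation the brackets are sines of half-angle differences, and twice the signed area
    of an inscribed triangle is [4 r^2] times three such sines. *)
Lemma orient_param o r a b c xa ya xb yb xc yc :
    on_param o r a xa ya -> on_param o r b xb yb -> on_param o r c xc yc ->
  orient a b c = 4 * r ^+ 2 * (xa * yb - xb * ya) * (xb * yc - xc * yb) *
     (xa * yc - xc * ya) /
     ((xa ^+ 2 + ya ^+ 2) * (xb ^+ 2 + yb ^+ 2) * (xc ^+ 2 + yc ^+ 2)).
Proof.
move=> [/lt0r_neq0 na xaE yaE] [/lt0r_neq0 nb xbE ybE] [/lt0r_neq0 nc xcE ycE].
rewrite /orient xaE yaE xbE ybE xcE ycE; field.
by rewrite na nb nc.
Qed.

Lemma on_param_inj o r a b xa ya xb yb :
    on_param o r a xa ya -> on_param o r b xb yb -> xa * yb - xb * ya = 0 ->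
  a = b.
Proof.
move=> [na axE ayE] [nb bxE byE] /subr0_eq E.
apply: eq_row2; rewrite ?axE ?bxE ?ayE ?byE -!mulrA; congr (_ + r * _);
  rewrite ?mulrA; apply/eqP; rewrite eqr_div ?lt0r_neq0 //; apply/eqP.
- have := congr1 (fun z => z ^+ 2) E; lra.
- have := congr1 ( *%R (xa * xb)) E; have := congr1 ( *%R (ya * yb)) E; lra.
Qed.

(** In the product of the two orientations the bracket of [a] and [b] is squared, and nonzero as
    [a != b]; it goes into the positive factor [K]. *)
Lemma param_segments_meet o r a b c d xa ya xb yb xc yc xd yd :
    0 < r -> a != b ->
    on_param o r a xa ya -> on_param o r b xb yb ->
    on_param o r c xc yc -> on_param o r d xd yd ->
  (segment a b `&` segment c d !=set0)%classic <->
  (xa * yc - xc * ya) * (xa * yd - xd * ya) *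
  (xb * yc - xc * yb) * (xb * yd - xd * yb) <= 0.
Proof.
move=> r0 nab pa pb pc pd.
have ca := on_param_circle pa; have cb := on_param_circle pb.
have cc := on_param_circle pc; have cd := on_param_circle pd.
have [na _ _] := pa; have [nb _ _] := pb; have [nc _ _] := pc; have [nd _ _] := pd.
have nb0 : xa * yb - xb * ya != 0.
  by apply: contraNneq nab => /(on_param_inj pa pb) ->.
rewrite (segments_meetP ca cb cc cd nab).
rewrite (orient_param pa pb pc) (orient_param pa pb pd).
set K := 16 * r ^+ 4 * (xa * yb - xb * ya) ^+ 2 /
  ((xa ^+ 2 + ya ^+ 2) ^+ 2 * (xb ^+ 2 + yb ^+ 2) ^+ 2 *
   (xc ^+ 2 + yc ^+ 2) * (xd ^+ 2 + yd ^+ 2)).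
have K0 : 0 < K.
  have K1 : 0 < (xa * yb - xb * ya) ^+ 2 by rewrite exprn_even_gt0.
  apply: divr_gt0; last by rewrite !mulr_gt0 // exprn_gt0.
  by apply: mulr_gt0 K1; rewrite mulr_gt0 ?exprn_gt0 ?ltr0n.
set X := (X in X <= 0); set Y := (X in _ <-> X <= 0).
suff -> : X = K * Y by rewrite pmulr_rle0.
by rewrite /X /Y /K; field; rewrite !lt0r_neq0.
Qed.

(* A shear preserves the brackets [x * y' - x' * y] and makes the finitely many
   parameters [y / x] finite. *)
Lemma shear_neq0 (E : finType) (x y : E -> R) :
  (forall e, 0 < x e ^+ 2 + y e ^+ 2) -> exists k, forall e, x e + k * y e != 0.
Proof.
(* [k] exceeds every [|x e / y e|], so it is never the root [- x e / y e]. *)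
move=> xy; pose k := 1 + \sum_e `|x e / y e|; exists k => e.
have [y0|y0] := eqVneq (y e) 0.
  by have := xy e; rewrite y0 expr0n addr0 mulr0 addr0 lt0r sqrf_eq0 => /andP[].
apply/eqP => E0.
have : k = - (x e / y e).
  apply: (mulIf y0); rewrite mulNr divfK //; apply/eqP.
  by rewrite -subr_eq0 opprK addrC E0.
have : `|x e / y e| <= \sum_e `|x e / y e|.
  by rewrite (bigD1 e) //= lerDl sumr_ge0.
have := ler_norm (- (x e / y e)); rewrite normrN /k; lra.
Qed.

(** The parameter of an end is its slope [T] after the shear. A bracket is a difference of slopes
    times two sheared abscissas; over the four pairs of ends each abscissa occurs twice, so the
    product differs from [crossing] by a nonzero square. *)
Lemma circle_graph_params (H : sgraph) :
  circle_graph R H -> exists s : H -> R * R,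
    (forall v, (s v).1 < (s v).2) /\
    forall u v, u != v -> adj u v <-> crossing (s u) (s v) <= 0.
Proof.
case=> o [r [c [r0 chord adjE]]].
have /choice[f fP] v : exists f : ('rV[R]_2 * (R * R)) * ('rV[R]_2 * (R * R)),
    [/\ on_param o r f.1.1 f.1.2.1 f.1.2.2, on_param o r f.2.1 f.2.2.1 f.2.2.2,
        f.1.1 != f.2.1 & c v = segment f.1.1 f.2.1].
  have [a [b [ca cb nab ->]]] := chord v.
  have [xa [ya pa]] := circle_on_param r0 ca.
  have [xb [yb pb]] := circle_on_param r0 cb.
  by exists ((a, (xa, ya)), (b, (xb, yb))).
have pos (e : H + H) :
    0 < (match e with inl v => (f v).1.2.1 | inr v => (f v).2.2.1 end) ^+ 2 +
        (match e with inl v => (f v).1.2.2 | inr v => (f v).2.2.2 end) ^+ 2.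
  by case: e => v; case: (fP v) => [[? _ _] [? _ _] _ _].
have [k kP] := shear_neq0 pos.
pose T (z : R * R) := z.2 / (z.1 + k * z.2).
pose s v := (T (f v).1.2, T (f v).2.2).
have bracket (z w : R * R) : z.1 + k * z.2 != 0 -> w.1 + k * w.2 != 0 ->
    z.1 * w.2 - w.1 * z.2 = (z.1 + k * z.2) * (w.1 + k * w.2) * (T w - T z).
  by move=> z0 w0; rewrite /T; field; rewrite z0 w0.
have Ta_neq_Tb v : T (f v).1.2 != T (f v).2.2.
  have [pa pb nab _] := fP v; apply: contraNneq nab => E; apply/eqP.
  apply: (on_param_inj pa pb).
  by rewrite (bracket _ _ (kP (inl v)) (kP (inr v))) E subrr mulr0.
pose t v := if (s v).1 < (s v).2 then s v else ((s v).2, (s v).1).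
exists t; split=> [v|u v uv].
  by have := Ta_neq_Tb v; rewrite /t neq_lt; case: ifP.
have -> : crossing (t u) (t v) = crossing (s u) (s v).
  by rewrite /t /crossing; case: ifP => _; case: ifP => _ //=; ring.
rewrite (adjE u v uv).
have [pa pb nab ->] := fP u; have [pc pd _ ->] := fP v.
rewrite (param_segments_meet r0 nab pa pb pc pd).
rewrite !(bracket _ _ (kP (inl u)) (kP (inl v)),
  bracket _ _ (kP (inl u)) (kP (inr v)), bracket _ _ (kP (inr u)) (kP (inl v)),
  bracket _ _ (kP (inr u)) (kP (inr v))).
have /= A0 := kP (inl u); have /= C0 := kP (inl v).
have /= B0 := kP (inr u); have /= D0 := kP (inr v).
rewrite /crossing /s /=.
set A := (f u).1.2.1 + _ in A0 *; set B := (f u).2.2.1 + _ in B0 *.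
set C := (f v).1.2.1 + _ in C0 *; set D := (f v).2.2.1 + _ in D0 *.
set X := (X in X <= 0); set Y := (X in _ <-> X <= 0).
suff -> : X = (A * B * C * D) ^+ 2 * Y.
  by rewrite pmulr_rle0 // exprn_even_gt0 ?mulf_neq0.
by rewrite /X /Y; ring.
Qed.

(** [P x] has half-angle direction [(1, x)]; the bracket of [(1, x)] and [(1, y)] is [y - x], so the
    product of the four brackets is [crossing] itself. *)
Lemma params_circle_graph (H : sgraph) (s : H -> R * R) :
    (forall v, (s v).1 < (s v).2) ->
    (forall u v, u != v -> adj u v <-> crossing (s u) (s v) <= 0) ->
  circle_graph R H.
Proof.
move=> lt_s adjE.
pose P x : 'rV[R]_2 := \row_i (if i == 0 then (1 - x ^+ 2) / (1 + x ^+ 2)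
                               else 2 * x / (1 + x ^+ 2)).
have PP x : on_param 0 1 (P x) 1 x.
  split; rewrite ?mxE /= ?expr1n; first by rewrite ltr_pwDl ?sqr_ge0.
  - by rewrite add0r mul1r.
  - by rewrite add0r mul1r mulr1.
(* The first coordinate of [P x] determines [2 / (1 + x ^+ 2)], and the second is [x] times that. *)
have P_inj x y : P x = P y -> x = y.
  move=> E; have := congr1 (fun p => xcoord p) E.
  have := congr1 (fun p => ycoord p) E.
  rewrite !mxE /=.
  have nx : 1 + x ^+ 2 != 0 by rewrite lt0r_neq0 // ltr_pwDl ?sqr_ge0.
  have ny : 1 + y ^+ 2 != 0 by rewrite lt0r_neq0 // ltr_pwDl ?sqr_ge0.
  have dbl (z : R) : 1 + z ^+ 2 != 0 ->
      1 + (1 - z ^+ 2) / (1 + z ^+ 2) = 2 / (1 + z ^+ 2).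
    by move=> ?; field.
  move=> h2 h1; have := dbl x nx; rewrite h1 dbl // => h3.
  have : 2 * x / (1 + x ^+ 2) = x * (2 / (1 + y ^+ 2)) by rewrite h3; field.
  rewrite h2 => h4; apply/esym; apply: (mulIf (x := 2 / (1 + y ^+ 2))).
    by rewrite mulf_neq0 ?invr_eq0 ?pnatr_eq0.
  by rewrite -h4; field.
exists 0, 1, (fun v => segment (P (s v).1) (P (s v).2)); split.
- exact: ltr01.
- move=> v; exists (P (s v).1), (P (s v).2); split=> //.
  + exact: on_param_circle (PP _).
  + exact: on_param_circle (PP _).
  + by apply: contraTneq (lt_s v) => /P_inj ->; rewrite ltxx.
- move=> u v uv; rewrite (adjE u v uv).
  have nab : P (s u).1 != P (s u).2.
    by apply: contraTneq (lt_s u) => /P_inj ->; rewrite ltxx.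
  rewrite (param_segments_meet ltr01 nab (PP _) (PP _) (PP _) (PP _)).
  rewrite !mul1r /crossing.
  set X := (X in X <= 0); set Y := (X in _ <-> X <= 0).
  by suff -> : X = Y by []; rewrite /X /Y; ring.
Qed.

End Chords.

(** * The complementary diagram drawn on a circle *)

Lemma crossing_nat (R : realDomainType) (V : finType) (l r : V -> nat) u v :
    distinct_ends l r -> u != v ->
  (crossing ((l u)%:R, (r u)%:R) ((l v)%:R, (r v)%:R) <= 0 :> R) =
  interlaced l r u v.
Proof.
move=> [lr lnr lnl rnr] uv.
rewrite crossing_le0E /= ?ltr_nat ?lr // !ler_nat /interlaced.
have := lnl u v uv; have := rnr u v uv; have := lnr u v; have := lnr v u.
have := lr u; have := lr v; lia.
Qed.

Theorem theorem1 (R : realType) (G : sgraph) :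
  bipartite G -> circle_graph R (compl G) -> circle_graph R G.
Proof.
move=> [A bipA] /circle_graph_params[s [lt_s adjE]].
have complE (u v : G) : u != v -> ~~ adj u v =
    interlaced (left_pos s) (right_pos s) u v.
  move=> uv; rewrite -(crossing_le0 lt_s uv).
  have -> : ~~ adj u v = @adj (compl G) u v by rewrite /= /compl_adj uv.
  by apply/idP/idP; apply adjE.
have clique (u v : G) : u != v -> (u \in A) = (v \in A) ->
    interlaced (left_pos s) (right_pos s) u v.
  move=> uv sameA; rewrite -complE //.
  by apply/negP => /bipA; rewrite sameA eqxx.
have [p [q arc]] := splitting_arc (distinct_ends_pos lt_s) clique.
have [l [r [dist compl_lr]]] := reflect_arc (distinct_ends_pos lt_s) arc.
apply: (@params_circle_graph R G (fun v => ((l v)%:R, (r v)%:R))).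
  by case: dist => lr _ _ _ v; rewrite /= ltr_nat.
by move=> u v uv; rewrite crossing_nat // compl_lr // -complE // negbK.
Qed.
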